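(* Let $\Omega \subset \mathbb{S}^1$ be a nonempty set such that for every $\omega\in\Omega$ the line through the origin and $\omega$ meets the segment $\{(1,u): 0\le u\le 1\}$. Suppose there exists $\eta>0$ such that, for every natural number $N$, the tree $\mathscr{T}_\Omega$ contains an $\eta$-separated subtree that is lacunary of order $N$. Then the directional maximal operator $M_\Omega$ is unbounded on $L^p(\mathbb{R}^2)$ for every $1\le p<\infty$; that is, for every $1\le p<\infty$ there is no finite constant $C$ such that $\|M_\Omega f\|_{L^p(\mathbb{R}^2)}\le C\|f\|_{L^p(\mathbb{R}^2)}$ for all $f\in L^p(\mathbb{R}^2)$.
   Context: Maximal operator. For nonempty $\Omega\subset\mathbb{S}^1$ and measurable $f$ on $\mathbb{R}^2$, $M_\Omega f(x)=\sup_{x\in R}\frac{1}{|R|}\int_R|f|$, where the supremum is over all open rectangles $R\subset\mathbb{R}^2$ containing $x$ with an edge of longest length oriented in one of the directions $\omega\in\Omega$. Directions as slopes. For $\Omega$ as in the claim, each line through the origin and $\omega\in\Omega$ meets $\{(1,u):0\le u\le1\}$ at a point $\omega_Q$; put $Q_\Omega=\{u\in[0,1] : (1,u)=\omega_Q \text{ for some } \omega\in\Omega\}$. Dyadic intervals. For a binary string $0j_1\ldots j_k$ with each $j_i\in\{0,1\}$ and $k\ge 0$, $Q_{0j_1\ldots j_k}$ is the closed interval $[\sum_{i=1}^k2^{-i}j_i,\ \sum_{i=1}^k2^{-i}j_i+2^{-k}]$; in particular $Q_0=[0,1]$. Binary tree. $\mathscr{B}$ is the graph whose vertices are $0$ and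 all finite strings $0a_1\ldots a_k$ with $a_i\in\{0,1\}$, with edges joining $0$ to $0a_1$ and $0a_1\ldots a_{k-1}$ to $0a_1\ldots a_{k-1}a_k$. A vertex $0a_1\ldots a_k$ has height $k$, written $h(0a_1\ldots a_k)=k$, and $h(0)=0$. If $u,v$ are joined by an edge and $h(v)=1+h(u)$, then $u$ is the parent of $v$ and $v$ is a child of $u$; ancestors and descendants are obtained by following chains of parents and children. A vertex of a subtree $\mathscr{T}\subset\mathscr{B}$ splits in $\mathscr{T}$ (is a splitting vertex) if it has two children in $\mathscr{T}$. A ray in $\mathscr{T}$ is a (possibly infinite) maximal sequence of vertices $v_1,v_2,\ldots$ of $\mathscr{T}$ with $v_{j+1}$ a child of $v_j$; it is maximal in the sense that it does not terminate at a vertex having descendants in $\mathscr{T}$. The tree of $\Omega$. $\mathscr{T}_\Omega$ is the smallest subtree of $\mathscr{B}$ containing $0$ and all vertices $0a_1\ldots a_k$ such that $Q_{0a_1\ldots a_k}\cap Q_\Omega\neq\emptyset$. Lacunary trees. A tree $\mathscr{T}\subset\mathscr{B}$ is lacunary of order $0$ if it consists of a single ray containing $0$. It is lacunary of order $N$ ($N\ge1$) if all of its splitting vertices lie on a lacunary tree of order $N-1$; it is understood that a tree said to be lacunary of order $N$ is not lacunary of any order lower than $N$. $\eta$-separation. For $\eta>0$, a tree $\mathscr{T}\subset\mathscr{B}$ is $\eta$-separated if for any splitting vertex $0a_1\ldots a_k$ of $\mathscr{T}$, any two of its descendants $u,v$ in $\mathscr{T}$ that are splitting vertices of $\mathscr{T}$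 and lie on separate halves of the interval $Q_{0a_1\ldots a_k}$ (that is, $Q_u$ is contained in one half and $Q_v$ in the other) are such that the Euclidean distance between $Q_u$ and $Q_v$ is at least $\eta$ times the length of $Q_{0a_1\ldots a_k}$. *)

(* Defs.v *)
From mathcomp Require Import all_boot all_order all_algebra.
From mathcomp Require Import all_classical all_reals all_analysis.
Set Implicit Arguments.
Unset Strict Implicit.
Unset Printing Implicit Defensive.
Import Order.TTheory GRing.Theory Num.Theory.
Import numFieldNormedType.Exports.

Local Open Scope classical_set_scope.
Local Open Scope ring_scope.

(* The plane carries the Borel sigma-algebra.  Its norm as a product in the
   library is the sup norm, so Euclidean notions are written in coordinates. *)
Notation plane R := (measurableTypeR R * measurableTypeR R)%type.

Definition lebesgue2 (R : realType) : {measure set (plane R) -> \bar R} :=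
  (@lebesgue_measure R \x @lebesgue_measure R)%E.

Definition unit_circle (R : realType) : set (plane R) :=
  [set w | w.1 ^+ 2 + w.2 ^+ 2 = 1].
Arguments unit_circle : clear implicits.

(* The open rectangle with centre c, edges of length a along the unit vector w
   and edges of length b along its rotation by a right angle. *)
Definition rectangle (R : realType) (c w : plane R) (a b : R) : set (plane R) :=
  [set x | `|(x.1 - c.1) * w.1 + (x.2 - c.2) * w.2| < a / 2 /\
           `|(x.2 - c.2) * w.1 - (x.1 - c.1) * w.2| < b / 2].

Definition directional_rectangles (R : realType) (Om : set (plane R)) :
    set (set (plane R)) :=
  [set A | exists w c a b,
    [/\ Om w, 0 < b, b <= a & A = rectangle c w a b]].

Definition maximal_op (R : realType) (Om : set (plane R)) (f : plane R -> R)
    (x : plane R) : \bar R :=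
  ereal_sup [set ((\int[lebesgue2 R]_(y in A) `|f y|%:E) / lebesgue2 R A)%E
            | A in [set A | directional_rectangles Om A /\ A x]].

Definition origin_line (R : realType) (w : plane R) : set (plane R) :=
  [set (t * w.1, t * w.2) | t in [set: R]].

Definition slope_segment (R : realType) : set (plane R) :=
  [set (1, u) | u in `[0, 1]%classic].
Arguments slope_segment : clear implicits.

Definition slopes (R : realType) (Om : set (plane R)) : set R :=
  [set u | u \in `[0, 1]%R /\ exists2 w, Om w & origin_line w (1, u)].

(* The vertex 0 a_1 ... a_k of the binary tree is encoded by a_1, ..., a_k,
   without the leading 0: the root is [::] and the height is size. *)
Definition vertex := seq bool.

Definition dyadic_left (R : realType) (v : vertex) : R :=
  \sum_(i < size v) (nth false v i)%:R * 2 ^- i.+1.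

Definition dyadic (R : realType) (v : vertex) : set R :=
  [set` `[dyadic_left R v, dyadic_left R v + 2 ^- size v]].
Arguments dyadic : clear implicits.

Definition child (u v : vertex) : bool := [exists b : bool, v == rcons u b].

Definition edge (u v : vertex) : bool := child u v || child v u.

(* A connected subgraph of a tree is determined by its vertices, so subtrees
   are represented by their (nonempty) vertex sets; they need not contain the
   root. *)
Definition subtree (T : set vertex) : Prop :=
  T !=set0 /\
  forall u v, T u -> T v -> exists s : seq vertex,
    [/\ path edge u s, last u s = v & forall z, z \in s -> T z].

Definition descendant (T : set vertex) (u v : vertex) : Prop :=
  exists s : seq vertex,
    [/\ s <> [::], path child u s, last u s = v & forall z, z \in s -> T z].

Definition splits (T : set vertex) (v : vertex) : Prop :=
  T v /\ forall b, T (rcons v b).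

(* A is the set of terms of a ray in T, infinite or finite.  Maximality
   concerns only the end of the ray, and so is void for an infinite one. *)
Definition ray (T A : set vertex) : Prop :=
  A `<=` T /\
  ((exists2 v : nat -> vertex, (forall j, child (v j) (v j.+1)) & A = range v)
   \/ (exists x s, [/\ path child x s, A = [set` x :: s] &
                      ~ exists u, descendant T (last x s) u])).

(* Lacunarity of order N before the convention that the order is minimal. *)
Fixpoint weakly_lacunary (N : nat) (T : set vertex) : Prop :=
  subtree T /\
  match N with
  | 0 => exists A, [/\ ray T A, A [::] & T = A]
  | N'.+1 => exists2 T', weakly_lacunary N' T' & splits T `<=` T'
  end.

(* Minimality is imposed on T only; it passes to the auxiliary trees, since a
   lower order for one of them would yield a lower order for T. *)
Definition lacunary (N : nat) (T : set vertex) : Prop :=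
  weakly_lacunary N T /\ forall M, (M < N)%N -> ~ weakly_lacunary M T.

Definition set_dist (R : realType) (A B : set R) : R :=
  inf [set `|x - y| | x in A & y in B].

(* The halves of dyadic R w are dyadic R (rcons w b), for b = false, true. *)
Definition eta_separated (R : realType) (eta : R) (T : set vertex) : Prop :=
  forall w u v b,
    splits T w ->
    descendant T w u -> splits T u -> dyadic R u `<=` dyadic R (rcons w b) ->
    descendant T w v -> splits T v -> dyadic R v `<=` dyadic R (rcons w (~~ b)) ->
    eta * 2 ^- size w <= set_dist (dyadic R u) (dyadic R v).

Definition direction_tree (R : realType) (Om : set (plane R)) : set vertex :=
  smallest subtree
    [set v | v = [::] \/ dyadic R v `&` slopes Om !=set0].

(* Main.v *)
(* Minimality of the order produces, for every [n], a perfect binary tree of depth [n] of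
   slopes in which, by eta-separation, the spread of each subtree is tiny compared to its
   distance from its sibling.  At a node with slopes [v0 < v1], cut the vertical axis into
   intervals of length [v1 - v0] with a random phase, and let the even intervals carry
   the strips of slope [v0] and the odd ones those of slope [v1]; inside each strip go on
   with the subtree.  At abscissa [x] in [0, 1], a point lies in an admissible strip of
   each sort with probability [1 / 2] and of both with probability [x / 2], so the
   probability [P] to lie in a strip of every generation satisfies
   [P' = P - (x / 2) * P ^ 2], whence [P] is of order [1 / (1 + n * x)].  The random
   Kakeya set so obtained has expected area of order [1 / n] over [1/2 <= x <= 1] but
   [log n / n] over [0 <= x <= 1/2].  The maximal function of the indicator of the
   first part is at least [1 / 20] on the second one, along the strips. *)

Require Import Defs.
From mathcomp Require Import all_boot all_order all_algebra.
From mathcomp Require Import all_classical all_reals all_analysis measurable_realfun.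
From mathcomp Require Import ring lra zify.
Set Implicit Arguments.
Unset Strict Implicit.
Unset Printing Implicit Defensive.
Import Order.TTheory GRing.Theory Num.Theory.
Import numFieldNormedType.Exports HBNNSimple.
Local Open Scope classical_set_scope.
Local Open Scope ring_scope.

(** * Subtrees and splitting vertices *)

Lemma childP (u v : vertex) : reflect (exists b, v = rcons u b) (child u v).
Proof.
apply: (iffP existsP) => [[b /eqP->]|[b ->]]; exists b => //.
Qed.

(** The vertices extending [c] are joined to the rest of the binary tree only by the edge from [c]
    to its parent. *)
Lemma edge_exit (c u v : vertex) : edge u v -> prefix c u -> ~~ prefix c v ->
  u = c /\ child v c.
Proof.
case/orP => /childP [b ->].
  by move=> cu; rewrite (prefix_trans cu)// prefix_rcons.
move=> /prefixP[s]; case: (lastP s) => [|s' b'].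
  by rewrite cats0 => <- _; split => //; apply/childP; exists b.
by rewrite -rcons_cat => /rcons_inj[-> _]; rewrite prefix_prefix.
Qed.

(** A path in [T] that leaves the part below [rcons w i] must use the edge from [rcons w i] to
    [w]. *)
Lemma subtree_exit (T : set vertex) (w a b : vertex) (i : bool) : subtree T ->
  T a -> T b -> prefix (rcons w i) a -> ~~ prefix (rcons w i) b ->
  T (rcons w i) /\ T w.
Proof.
move=> [_ conn] Ta Tb; have [s [ps lsb sT]] := conn _ _ Ta Tb.
elim: s a Ta ps lsb sT => [|z s IH] a Ta /=.
  by move=> _ -> _ ->.
move=> /andP[az pzs] lsb sT wa wb.
have Tz : T z by apply: sT; rewrite mem_head.
have [wz|wz] := boolP (prefix (rcons w i) z).
  apply: IH pzs lsb _ wz wb => // y ys; apply: sT; rewrite in_cons ys orbT//.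
have [ac /childP [b' /rcons_inj [wE _]]] := edge_exit az wa wz.
by rewrite -ac wE.
Qed.

Lemma prefix_rconsF (w u : vertex) b : prefix (rcons w b) u ->
  ~~ prefix (rcons w (~~ b)) u.
Proof.
rewrite !prefixE !size_rcons => /eqP ->.
by apply/eqP => /rcons_inj[]; case: b.
Qed.

(** Any two vertices are joined through the root. *)
Lemma prefix_closed_subtree (S : set vertex) : S !=set0 ->
  (forall v b, S (rcons v b) -> S v) -> subtree S.
Proof.
move=> S0 cl; split => // u v Su Sv.
have up : exists s, [/\ path edge u s, last u s = [::] & forall z, z \in s -> S z].
  elim/last_ind: u Su => [|u b IH] Su; first by exists [::].
  have [s [ps ls sS]] := IH (cl _ _ Su).
  exists (u :: s); split => //=; last first.
    by move=> z; rewrite in_cons => /orP[/eqP->|/sS//]; exact: cl Su.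
  by rewrite ps andbT; apply/orP; right; apply/childP; exists b.
have down : exists s, [/\ path edge [::] s, last [::] s = v & forall z, z \in s -> S z].
  elim/last_ind: v Sv => [|v b IH] Sv; first by exists [::].
  have [s [ps ls sS]] := IH (cl _ _ Sv).
  exists (rcons s (rcons v b)); split; last first.
    by move=> z; rewrite mem_rcons in_cons => /orP[/eqP->|/sS//].
  - by rewrite last_rcons.
  - by rewrite rcons_path ps ls; apply/orP; left; apply/childP; exists b.
have [s [ps ls sS]] := up; have [t [pt lt tS]] := down.
exists (s ++ t); rewrite cat_path ps ls last_cat ls; split => // z.
by rewrite mem_cat => /orP[/sS|/tS].
Qed.

(* A splitting vertex below which [T] keeps splitting in both directions [n] more
   times. *)
Fixpoint splitting_rank (T : set vertex) (n : nat) (w : vertex) : Prop :=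
  splits T w /\
  if n is n'.+1 then
    forall b, exists2 w', prefix (rcons w b) w' & splitting_rank T n' w'
  else True.

Lemma splitting_rank_splits T n w : splitting_rank T n w -> splits T w.
Proof. by case: n => [|n] []. Qed.

(** A default auxiliary tree, used when there are no splitting vertices to cover. *)
Lemma weakly_lacunary_left_ray n : weakly_lacunary n (range (nseq^~ false)).
Proof.
have st : subtree (range (nseq^~ false)).
  apply: prefix_closed_subtree; first by exists [::], 0%N.
  move=> v b [[|k] _]; first by case: v.
  by rewrite -(addn1 k) nseqD cats1 => /rcons_inj[<- _]; exists k.
elim: n => [|n IH]; split => //.
  exists (range (nseq^~ false)); split => //; last by exists 0%N.
  split => //; left; exists (nseq^~ false) => // j.
  by apply/childP; exists false; rewrite -(addn1 j) nseqD cats1.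
by exists (range (nseq^~ false)) => // v [].
Qed.

(** The auxiliary tree consists of the splitting vertices of [T] and their ancestors. A vertex
    splitting there splits in [T] and has splitting vertices of [T] below both children, so rank [n]
    there yields rank [n.+1] in [T]. *)
Lemma weakly_lacunary_of_rank (n : nat) (T : set vertex) : subtree T ->
  ~ (exists w, splitting_rank T n w) -> weakly_lacunary n.+1 T.
Proof.
elim: n T => [|n IH] T sT nrk.
  split => //; exists (range (nseq^~ false)); first exact: weakly_lacunary_left_ray.
  by move=> v sv; exfalso; apply: nrk; exists v; split.
have [spl0|spl] := pselect (splits T !=set0); last first.
  split => //; exists (range (nseq^~ false)); first exact: weakly_lacunary_left_ray.
  by move=> v sv; exfalso; apply: spl; exists v.
pose T' := [set v | exists2 w, prefix v w & splits T w].
have sT' : subtree T'.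
  apply: prefix_closed_subtree.
    by have [w sw] := spl0; exists w, w => //; exact: prefix_refl.
  move=> v b [w vw sw]; exists w => //.
  by apply: prefix_trans vw; exact: prefix_rcons.
have below w b : T' (rcons w b) ->
    exists2 w', prefix (rcons w b) w' & splitting_rank T 0 w'.
  by move=> [w' ww' sw']; exists w'.
have splT w : splits T' w -> splits T w.
  (* Splitting vertices of [T] lie below both children of [w]; the path in [T] between them runs
     through [w] and these children. *)
  move=> [_ s]; have st b : T (rcons w b) /\ T w.
    have [u pu [Tu _]] := s b; have [v pv [Tv _]] := s (~~ b).
    apply: (subtree_exit sT Tu Tv pu).
    by rewrite -[b]negbK; apply: prefix_rconsF.
  by split => [|b]; [have [] := st true|have [] := st b].
split => //; exists T'; last by move=> v sv; exists v => //; exact: prefix_refl.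
apply: IH => // -[w rw]; apply: nrk; exists w.
elim: n w rw => [|n IHn] w [sw].
  by move=> _; split; [exact: splT|move=> b; apply: below; apply: sw.2].
move=> h; split; first exact: splT.
by move=> b; have [w' ww' rw'] := h b; exists w' => //; exact: IHn.
Qed.

Lemma lacunary_rank (n : nat) (T : set vertex) : subtree T -> lacunary n.+2 T ->
  exists w, splitting_rank T n w.
Proof.
move=> sT [_ /(_ n.+1 (ltnSn _))]; apply: contra_notP.
exact: weakly_lacunary_of_rank.
Qed.

(** Each unit of rank given up lengthens the vertex by at least one letter, hence at least halves
    its dyadic interval. *)
Lemma splitting_rank_descend (T : set vertex) (n k : nat) (w : vertex) :
  splitting_rank T (n + k) w ->
  exists w', [/\ prefix w w', (size w + k <= size w')%N & splitting_rank T n w'].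
Proof.
elim: k w => [|k IH] w.
  by rewrite addn0 => h; exists w; rewrite prefix_refl addn0.
rewrite addnS => -[_ /(_ true)[w1 ww1 /IH[w' [w1w' sz rk]]]].
exists w'; split => //.
  by apply: prefix_trans w1w'; apply: prefix_trans ww1; exact: prefix_rcons.
apply: leq_trans sz; rewrite addnS -addSn leq_add2r -(size_rcons w true).
exact: size_prefix.
Qed.

Lemma subtree_descendant (T : set vertex) (u v : vertex) : subtree T ->
  T u -> T v -> prefix u v -> u != v -> descendant T u v.
Proof.
move=> sT Tu Tv /prefixP[s vE]; move: Tv; rewrite {v}vE.
elim/last_ind: s => [|s b IH] Tv uv; first by rewrite cats0 eqxx in uv.
rewrite -rcons_cat in Tv *.
have [T1 T2] : T (rcons (u ++ s) b) /\ T (u ++ s).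
  apply: (subtree_exit sT Tv Tu (prefix_refl _)); apply/negP => /size_prefix.
  by rewrite size_rcons size_cat -addnS -[X in (_ <= X)%N]addn0 leq_add2l.
have [s0|s0] := eqVneq u (u ++ s).
  exists [:: rcons (u ++ s) b]; split => //=.
    by rewrite andbT; apply/childP; exists b; rewrite -s0.
  by move=> z; rewrite inE => /eqP ->.
have [r [r0 pr lr rT]] := IH T2 s0.
exists (rcons r (rcons (u ++ s) b)); split; last first.
- by move=> z; rewrite mem_rcons inE => /orP[/eqP ->|/rT].
- by rewrite last_rcons.
- by rewrite rcons_path pr lr; apply/childP; exists b.
- by case: (r).
Qed.

(** * Trees of slopes *)

Lemma dyadic_left_rcons (R : realType) v b :
  dyadic_left R (rcons v b) = dyadic_left R v + b%:R * 2 ^- (size v).+1.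
Proof.
rewrite /dyadic_left size_rcons big_ord_recr /= nth_rcons ltnn eqxx.
by congr (_ + _); apply: eq_bigr => i _; rewrite nth_rcons ltn_ord.
Qed.

Lemma dyadicP (R : realType) v x :
  dyadic R v x <-> dyadic_left R v <= x <= dyadic_left R v + 2 ^- size v.
Proof. by rewrite /dyadic /= in_itv. Qed.

Lemma exprVnS (R : realType) n : 2 ^- n = 2 ^- n.+1 + 2 ^- n.+1 :> R.
Proof. by rewrite exprS invfM; lra. Qed.

Lemma dyadic_rcons (R : realType) v b : dyadic R (rcons v b) `<=` dyadic R v.
Proof.
move=> x /dyadicP; rewrite dyadic_left_rcons size_rcons => h.
apply/dyadicP; rewrite exprVnS.
have := exprn_gt0 (size v).+1 (ltr0Sn R 1); rewrite -invr_gt0.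
by case: b h => /=; lra.
Qed.

Lemma dyadic_prefix (R : realType) u v : prefix u v -> dyadic R v `<=` dyadic R u.
Proof.
move=> /prefixP[s ->]; elim/last_ind: s => [|s b IH]; first by rewrite cats0.
by rewrite -rcons_cat; apply: subset_trans IH; exact: dyadic_rcons.
Qed.

Lemma dyadic_dist (R : realType) v x y : dyadic R v x -> dyadic R v y ->
  `|x - y| <= 2 ^- size v.
Proof. by move=> /dyadicP ? /dyadicP ?; rewrite ler_norml; lra. Qed.

Lemma dyadic_halves (R : realType) v x y :
  dyadic R (rcons v false) x -> dyadic R (rcons v true) y -> x <= y.
Proof.
by move=> /dyadicP + /dyadicP; rewrite !dyadic_left_rcons !size_rcons /=; lra.
Qed.

Lemma set_dist_le (R : realType) (A B : set R) x y : A x -> B y ->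
  set_dist A B <= `|x - y|.
Proof.
move=> Ax By; apply: ge_inf; last by exists x => //; exists y.
by exists 0 => _ [a _ [b _ <-]].
Qed.

(** The right-hand side is itself a subtree containing the root, so the smallest such subtree lies
    in it. *)
Lemma direction_tree_sub (R : realType) (Om : set (plane R)) : Om !=set0 ->
  (forall w, Om w -> origin_line w `&` slope_segment R !=set0) ->
  direction_tree Om `<=` [set v | dyadic R v `&` slopes Om !=set0].
Proof.
move=> [w Omw] seg.
have root : dyadic R [::] `&` slopes Om !=set0.
  have [z [lw [u u01 uE]]] := seg w Omw.
  exists u; split; last by split => //; exists w => //; rewrite uE.
  move: u01; rewrite /dyadic /= !in_itv /= /dyadic_left big_ord0 expr0 invr1.
  by rewrite add0r.
move=> v; apply; split; last by move=> u [->|].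
apply: prefix_closed_subtree; first by exists [::].
by move=> {}v b [u [vu Su]]; exists u; split => //; exact: dyadic_rcons vu.
Qed.

Inductive slope_tree (R : Type) :=
  | Leaf of R
  | Node of R & R & slope_tree R & slope_tree R.
Arguments Leaf {R}.
Arguments Node {R}.

(* Perfect trees of depth [n] with leaves in [S]; [v0] and [v1] are approximate slopes
   of the two subtrees of a node, whose spread is small compared to [v1 - v0]. *)
Fixpoint well_spread (R : realType) (k : R) (n : nat) (S : set R)
    (t : slope_tree R) : Prop :=
  match n, t with
  | 0, Leaf u => S u
  | n'.+1, Node v0 v1 l r =>
      [/\ v0 < v1,
        well_spread k n' (S `&` [set u | `|u - v0| <= k * (v1 - v0)]) l &
        well_spread k n' (S `&` [set u | `|u - v1| <= k * (v1 - v0)]) r]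
  | _, _ => False
  end.

Lemma well_spread_sub (R : realType) (k : R) (n : nat) (S S' : set R) t :
  S `<=` S' -> well_spread k n S t -> well_spread k n S' t.
Proof.
elim: n S S' t => [|n IH] S S' [u|v0 v1 l r]//= SS'; first exact: SS'.
by move=> [v01 wl wr]; split => //; [move: wl|move: wr]; apply: IH; exact: setSI.
Qed.

(** Each level of the slope tree spends [m.+1] units of rank: one to branch at [w] and [m] to shrink
    the intervals. Separation keeps the two chosen slopes [eta * 2 ^- size w] apart, while each
    branch stays in an interval of length at most [2 ^- (size w + m.+1)]. *)
Lemma well_spread_of_rank (R : realType) (S : set R) (T : set vertex) (eta k : R)
    (m n : nat) (w : vertex) :
  subtree T -> T `<=` [set v | dyadic R v `&` S !=set0] ->
  eta_separated eta T -> 0 < eta -> 0 < k -> 2 ^- m.+1 <= k * eta ->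
  splitting_rank T (n * m.+1) w -> exists t, well_spread k n (S `&` dyadic R w) t.
Proof.
move=> sT TS sep eta0 k0 mE; elim: n w => [|n IH] w.
  move=> /splitting_rank_splits [/TS [u [wu Su]] _].
  by exists (Leaf u).
rewrite mulSnr addnS => -[sw children].
have branch b : exists w' t, [/\ prefix (rcons w b) w', splits T w',
    (size w + m.+1 <= size w')%N & well_spread k n (S `&` dyadic R w') t].
  have [w1 ww1 /splitting_rank_descend[w2 [w12 sz rk]]] := children b.
  have [t wst] := IH _ rk; exists w2, t; split => //.
  - exact: prefix_trans w12.
  - exact: splitting_rank_splits rk.
  - apply: leq_trans sz; rewrite addnS -addSn leq_add2r -(size_rcons w b).
    exact: size_prefix.
have [w0 [t0 [p0 s0 z0 ws0]]] := branch false.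
have [w1 [t1 [p1 s1 z1 ws1]]] := branch true.
have [v0 [Q0 _]] := TS _ s0.1; have [v1 [Q1 _]] := TS _ s1.1.
have desc b w' : prefix (rcons w b) w' -> splits T w' -> descendant T w w'.
  move=> pw' sw'; apply: subtree_descendant => //; [exact: sw.1|exact: sw'.1| |].
    by apply: prefix_trans pw'; exact: prefix_rcons.
  apply/eqP => ww'; have := size_prefix pw'.
  by rewrite -ww' size_rcons ltnn.
have v01 : eta * 2 ^- size w <= v1 - v0.
  have := sep w w0 w1 false sw (desc _ _ p0 s0) s0 (dyadic_prefix p0)
    (desc _ _ p1 s1) s1 (dyadic_prefix p1).
  move=> /le_trans/(_ (set_dist_le Q0 Q1)); rewrite distrC ger0_norm// subr_ge0.
  by apply: (@dyadic_halves _ w); [exact: dyadic_prefix Q0|exact: dyadic_prefix Q1].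
have small w' : (size w + m.+1 <= size w')%N -> 2 ^- size w' <= k * (v1 - v0).
  move=> sz; apply: (@le_trans _ _ (2 ^- (size w + m.+1))).
    by rewrite lef_pV2 ?posrE ?exprn_gt0// ler_weXn2l// ler1n.
  rewrite exprD invfM; apply: (@le_trans _ _ (2 ^- size w * (k * eta))).
    by rewrite ler_wpM2l// invr_ge0 exprn_ge0.
  by rewrite mulrCA [_ * eta]mulrC; apply: ler_wpM2l => //; exact: ltW.
exists (Node v0 v1 t0 t1); split.
- by rewrite -subr_gt0; apply: lt_le_trans v01; rewrite mulr_gt0// invr_gt0 exprn_gt0.
- apply: well_spread_sub ws0 => u [Su Qu]; split.
    split => //; apply: dyadic_prefix Qu; apply: prefix_trans p0.
    exact: prefix_rcons.
  by apply: (le_trans (dyadic_dist Qu Q0)); exact: small.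
- apply: well_spread_sub ws1 => u [Su Qu]; split.
    split => //; apply: dyadic_prefix Qu; apply: prefix_trans p1.
    exact: prefix_rcons.
  by apply: (le_trans (dyadic_dist Qu Q1)); exact: small.
Qed.

Lemma exists_well_spread (R : realType) (Om : set (plane R)) (k : R) (n : nat) :
  Om !=set0 ->
  (forall w, Om w -> origin_line w `&` slope_segment R !=set0) ->
  (exists2 eta : R, 0 < eta & forall N : nat, exists T : set vertex,
     [/\ T `<=` direction_tree Om, subtree T, eta_separated eta T & lacunary N T]) ->
  0 < k -> exists t, well_spread k n (slopes Om) t.
Proof.
move=> Om0 seg [eta eta0 lac] k0.
have keta : 0 < k * eta by exact: mulr_gt0.
(* With [m] the integer part of [(k * eta)^-1], [2 ^ m.+1 > m.+1 > (k * eta)^-1]. *)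
have mE : 2 ^- (Num.truncn (k * eta)^-1).+1 <= k * eta.
  rewrite -[leRHS]invrK lef_pV2 ?posrE ?invr_gt0 ?exprn_gt0//.
  apply: ltW; apply: (lt_le_trans (truncnS_gt _)).
  by rewrite -natrX ler_nat ltnW// ltn_expl.
have [T [TOm sT sepT lacT]] := lac (n * (Num.truncn (k * eta)^-1).+1).+2.
have [w rw] := lacunary_rank sT lacT.
have TS := subset_trans TOm (direction_tree_sub Om0 seg).
have [t wt] := well_spread_of_rank sT TS sepT eta0 k0 mE rw.
by exists t; apply: well_spread_sub wt => u [].
Qed.

(** * Percolation along a tree of slopes *)

(** Expectation under the uniform law; with finitely many outcomes the random construction only
    involves finite sums. *)
Definition mean (R : realType) (T : finType) (f : T -> R) : R :=
  (\sum_x f x) / #|T|%:R.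

Lemma eq_mean (R : realType) (T : finType) (f g : T -> R) : f =1 g -> mean f = mean g.
Proof. by move=> fg; congr (_ / _); apply: eq_bigr => x _. Qed.

Lemma meanD (R : realType) (T : finType) (f g : T -> R) :
  mean (fun x => f x + g x) = mean f + mean g.
Proof. by rewrite /mean big_split mulrDl. Qed.

Lemma meanB (R : realType) (T : finType) (f g : T -> R) :
  mean (fun x => f x - g x) = mean f - mean g.
Proof. by rewrite /mean sumrB mulrBl. Qed.

(** Independence of the two coordinates of a uniform pair. *)
Lemma mean_prod (R : realType) (T1 T2 : finType) (f : T1 -> R) (g : T2 -> R) :
  mean (fun x : T1 * T2 => f x.1 * g x.2) = mean f * mean g.
Proof.
rewrite /mean card_prod natrM invfM mulrACA; congr (_ * _).
by rewrite big_distrlr /= pair_bigA.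
Qed.

Lemma mean1 (R : realType) (T : finType) : (0 < #|T|)%N ->
  mean (fun _ : T => 1) = 1 :> R.
Proof. by move=> T0; rewrite /mean sumr_const divff// pnatr_eq0 -lt0n. Qed.

Lemma le_mean (R : realType) (T : finType) (f g : T -> R) :
  (forall x, f x <= g x) -> mean f <= mean g.
Proof. by move=> fg; rewrite ler_wpM2r// ler_sum. Qed.

Lemma mean_ge0 (R : realType) (T : finType) (f : T -> R) :
  (forall x, 0 <= f x) -> 0 <= mean f.
Proof. by move=> f0; rewrite mulr_ge0// sumr_ge0. Qed.

(** An outcome is an independent shift at every node, counted in cells; [M.*2] cells make a full
    period. *)
Fixpoint sample (R : realType) (M : nat) (t : slope_tree R) : finType :=
  match t with
  | Leaf _ => unit : finType
  | Node _ _ l r => ('I_M.*2 * (sample M l * sample M r))%type : finType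
  end.

(* The cell of the point [z] in the grid of mesh [d / M] carried by the vertical axis,
   after projecting [z] along the slope [v]. *)
Definition cell (R : realType) (M : nat) (v d : R) (z : plane R) : int :=
  Num.floor (M%:R * (z.2 - z.1 * v) / d).

(** In each period the first [M] cells go to [b = false], the left subtree, and the last [M] to
    [b = true]. *)
Definition side (M : nat) (b : bool) (c : int) : bool :=
  (c %% M.*2%:Z < M%:Z)%Z (+) b.

Definition near_side (M : nat) (b : bool) (c : int) : bool :=
  [|| side M b (c - 1), side M b c | side M b (c + 1)].

(* For [phi = side M], a node lets its left subtree survive on one half of the period of
   its randomly shifted grid, and its right subtree on the other half. *)
Fixpoint survives (R : realType) (M : nat) (phi : bool -> int -> bool)
    (t : slope_tree R) : sample M t -> plane R -> bool :=
  match t return sample M t -> plane R -> bool with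
  | Leaf _ => fun _ _ => true
  | Node v0 v1 l r => fun om z =>
     phi false (cell M v0 (v1 - v0) z + (om.1 : nat)%:Z) && survives phi om.2.1 z ||
     phi true (cell M v1 (v1 - v0) z + (om.1 : nat)%:Z) && survives phi om.2.2 z
  end.

Lemma card_sample (R : realType) (M : nat) (t : slope_tree R) :
  (0 < M)%N -> (0 < #|sample M t|)%N.
Proof.
move=> M0; elim: t => [u|v0 v1 l IHl r IHr] /=; first by rewrite card_unit.
by rewrite card_prod muln_gt0 card_ord double_gt0 M0 card_prod muln_gt0 IHl.
Qed.

Definition survival (R : realType) (M : nat) (phi : bool -> int -> bool)
    (t : slope_tree R) (z : plane R) : R :=
  mean (fun om : sample M t => (survives phi om z)%:R).

Definition frequency (R : realType) (M : nat) (phi : int -> bool) : R :=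
  mean (fun s : 'I_M.*2 => (phi (s : nat)%:Z)%:R).

(** Inclusion-exclusion, the two subtrees being independent of each other and of the shift at the
    node. Both branches share that shift, so their joint frequency need not factor. *)
Lemma survival_node (R : realType) (M : nat) (phi : bool -> int -> bool)
    (v0 v1 : R) (l r : slope_tree R) (z : plane R) : (0 < M)%N ->
  let A := cell M v0 (v1 - v0) z in let B := cell M v1 (v1 - v0) z in
  survival M phi (Node v0 v1 l r) z =
    frequency R M (fun c => phi false (A + c)) * survival M phi l z +
    frequency R M (fun c => phi true (B + c)) * survival M phi r z -
    frequency R M (fun c => phi false (A + c) && phi true (B + c)) *
      (survival M phi l z * survival M phi r z).
Proof.
move=> M0 A B.
rewrite -[survival M phi l z in X in X + _ - _]mulr1 -(mean1 R (card_sample r M0)).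
rewrite -[survival M phi r z in X in _ + X - _]mul1r
  -[X in X * survival _ _ r z](mean1 R (card_sample l M0)).
rewrite -!mean_prod -meanD -meanB; apply: eq_mean => om /=.
by rewrite -/A -/B; case: (phi false _); case: (phi true _);
  case: (survives _ _ _); case: (survives _ _ _); rewrite /= ?mulr0n ?mulr1n; lra.
Qed.

Lemma survival_bound (R : realType) (M : nat) (phi : bool -> int -> bool)
    (t : slope_tree R) (z : plane R) : (0 < M)%N -> 0 <= survival M phi t z <= 1.
Proof.
move=> M0; rewrite mean_ge0//= -(mean1 R (card_sample t M0)); apply: le_mean => om.
by case: (survives _ _ _).
Qed.

(** * Counting cells in one period *)

Lemma le_frequency (R : realType) (M : nat) (phi psi : int -> bool) :
  (forall c, phi c -> psi c) -> frequency R M phi <= frequency R M psi.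
Proof.
by move=> pp; apply: le_mean => s; case: (phi _) (pp (s : nat)%:Z) => [->|].
Qed.

(** Moving a full period by one cell trades its first term for an equal last one. *)
Lemma frequency_shift (R : realType) (M : nat) (phi : int -> bool) (A : int) :
  (forall c, phi (c + M.*2%:Z) = phi c) ->
  frequency R M (fun c => phi (A + c)) = frequency R M phi.
Proof.
move=> per; rewrite /frequency /mean; congr (_ / _).
have step B : \sum_(s < M.*2) (phi (B + 1 + (s : nat)%:Z))%:R =
    \sum_(s < M.*2) (phi (B + (s : nat)%:Z))%:R :> R.
  have : \sum_(s < M.*2.+1) (phi (B + (s : nat)%:Z))%:R =
      \sum_(s < M.*2.+1) (phi (B + (s : nat)%:Z))%:R :> R by [].
  rewrite {1}big_ord_recl big_ord_recr /= per addr0 [RHS]addrC => /addrI <-.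
  by apply: eq_bigr => s _; congr (phi _)%:R; rewrite /bump leq0n; lia.
elim: A => [|n IH|n IH].
- by apply: eq_bigr => s _; rewrite add0r.
- by rewrite -addn1 PoszD step.
- by rewrite -IH -[in RHS](subrK 1 (- n%:Z)) step -addn1 PoszD opprD.
Qed.

Lemma frequency_range (R : realType) (M m : nat) : (0 < M)%N -> (m <= M.*2)%N ->
  frequency R M (fun c => c < m%:Z) = m%:R / (2 * M%:R).
Proof.
move=> M0 mM; rewrite /frequency /mean card_ord -[X in _ / X%:R]muln2 natrM [2 * _]mulrC.
congr (_ / _); rewrite -natr_sum; congr (_%:R).
transitivity (\sum_(s < M.*2 | (s < m)%N) 1)%N.
  by rewrite [RHS]big_mkcond; apply: eq_bigr => s _; rewrite ltz_nat; case: ltnP.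
by rewrite -(big_ord_widen _ (fun=> 1%N) mM) sum1_card card_ord.
Qed.

Lemma side_periodic (M : nat) (b : bool) (c : int) :
  side M b (c + M.*2%:Z) = side M b c.
Proof. by rewrite /side modzDr. Qed.

Lemma near_side_periodic (M : nat) (b : bool) (c : int) :
  near_side M b (c + M.*2%:Z) = near_side M b c.
Proof. by rewrite /near_side (addrAC c _ (-1)) (addrAC c _ 1) !side_periodic. Qed.

(** The window contains the cells of one period displaced by one cell, or backwards by up to [M]. *)
Lemma sideE (M : nat) (b : bool) (c : int) :
  - (M.*2%:Z) <= c < M.*2%:Z + M%:Z ->
  side M b c = [|| c < - M%:Z, 0 <= c < M%:Z | M.*2%:Z <= c] (+) b.
Proof.
move=> cM; rewrite /side; congr (_ (+) _).
have [c0|c0] := leP 0 c; last by rewrite -modzDr modz_small; lia.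
have [c1|c1] := leP (M.*2%:Z) c; last by rewrite modz_small; lia.
by rewrite -[c](subrK M.*2%:Z) modzDr modz_small; lia.
Qed.

Lemma frequency_eq (R : realType) (M : nat) (phi psi : int -> bool) :
  (forall c, 0 <= c < M.*2%:Z -> phi c = psi c) ->
  frequency R M phi = frequency R M psi.
Proof. by move=> pp; apply: eq_mean => s; rewrite pp//= ltz_nat ltn_ord. Qed.

Lemma frequencyC (R : realType) (M : nat) (phi : int -> bool) : (0 < M)%N ->
  frequency R M (fun c => ~~ phi c) = 1 - frequency R M phi.
Proof.
move=> M0; rewrite -(mean1 R (_ : (0 < #|'I_M.*2|)%N)) ?card_ord ?double_gt0//.
by rewrite -meanB; apply: eq_mean => s; case: (phi _) => /=; lra.
Qed.

Lemma frequencyU (R : realType) (M : nat) (phi psi : int -> bool) :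
  frequency R M (fun c => phi c || psi c) <= frequency R M phi + frequency R M psi.
Proof.
rewrite -meanD; apply: le_mean => s.
by case: (phi _); case: (psi _) => /=; lra.
Qed.

Lemma frequency_side (R : realType) (M : nat) (b : bool) (A : int) : (0 < M)%N ->
  frequency R M (fun c => side M b (A + c)) = 1 / 2.
Proof.
move=> M0; rewrite frequency_shift; last exact: side_periodic.
have M1 : M%:R != 0 :> R by rewrite pnatr_eq0 -lt0n.
have lowE : frequency R M (side M false) = 1 / 2.
  rewrite (@frequency_eq _ _ _ (fun c => c < M%:Z)) ?frequency_range//.
  - by field.
  - by lia.
  - by move=> c cM; rewrite sideE; lia.
case: b => //; rewrite (@frequency_eq _ _ _ (fun c => ~~ side M false c)).
  by rewrite frequencyC// lowE; lra.
by move=> c _; rewrite /side addbF addbT.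
Qed.

(** A half of [M] cells gains at most one cell at each end, cyclically: [M + 2] cells out of
    [M.*2]. *)
Lemma frequency_near_side (R : realType) (M : nat) (b : bool) (A : int) : (0 < M)%N ->
  frequency R M (fun c => near_side M b (A + c)) <= 1 / 2 + 1 / M%:R.
Proof.
move=> M0; rewrite frequency_shift; last exact: near_side_periodic.
have M1 : M%:R != 0 :> R by rewrite pnatr_eq0 -lt0n.
have iM : 1 / 2 + 1 / M%:R = 1 / 2 + 2 / (2 * M%:R) :> R by field.
rewrite {}iM; set i := (2 * M%:R)^-1.
have Mi : M%:R * i = 1 / 2 by rewrite /i; field.
case: b.
  rewrite (@frequency_eq _ _ _ (fun c => ~~ (c < M.-1%:Z) || (c < 1%:Z))).
    apply: (le_trans (frequencyU _ _ _ _)).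
    rewrite frequencyC// !frequency_range//; [|lia|lia].
    by rewrite -subn1 natrB// -/i mulrBl; lra.
  by move=> c cM; rewrite /near_side !sideE; lia.
rewrite (@frequency_eq _ _ _ (fun c => (c < M.+1%:Z) || ~~ (c < M.*2.-1%:Z))).
  apply: (le_trans (frequencyU _ _ _ _)).
  rewrite frequencyC// !frequency_range//; [|lia|lia].
  rewrite -subn1 natrB; last by lia.
  by rewrite -natr1 -muln2 natrM -/i mulrBl mulrDl mulrAC; lra.
by move=> c cM; rewrite /near_side !sideE; lia.
Qed.

(** Once the common shift [A] is removed, with [D = A - B], both conditions hold within a period
    exactly when [0 <= c < D]. *)
Lemma frequency_both (R : realType) (M : nat) (A B : int) : (0 < M)%N ->
  0 <= A - B <= M%:Z ->
  frequency R M (fun c => side M false (A + c) && side M true (B + c)) =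
  (A - B)%:~R / (2 * M%:R).
Proof.
move=> M0; set D := A - B => DM.
have {1}-> : B = A - D by rewrite /D subKr.
transitivity (frequency R M (fun c => side M false c && side M true (c - D))).
  rewrite -[RHS](frequency_shift R A); first by apply: eq_mean => s; rewrite addrAC.
  by move=> c; rewrite addrAC !side_periodic.
case: D DM => [D|//] DM; rewrite -[Posz D]/(D%:Z) -pmulrn.
rewrite -frequency_range//; last by lia.
by apply: frequency_eq => c cM; rewrite !sideE; lia.
Qed.

(** * Cell indices and the recursion for the survival probability *)

Lemma floor_le_add (R : realType) (a b : R) (n : int) : a <= b + n%:~R ->
  Num.floor a <= Num.floor b + n.
Proof.
move=> ab; rewrite -ltzD1 -(ltr_int R) !rmorphD /=.
have := floor_itv a; have := floor_itv b; rewrite !rmorphD /=; lra.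
Qed.

(** Before rounding, the indices differ by exactly [M%:R * z.1], the mesh being proportional to
    [v1 - v0]. Through [frequency_both] this makes the overlap probability close to [z.1 / 2]. *)
Lemma cell_sub (R : realType) (M : nat) (v0 v1 : R) (z : plane R) :
  v0 < v1 -> 0 <= z.1 <= 1 ->
  let D := cell M v0 (v1 - v0) z - cell M v1 (v1 - v0) z in
  0 <= D <= M%:Z /\ M%:R * z.1 - 1 <= D%:~R <= M%:R * z.1 + 1.
Proof.
move=> v01 z01 /=; rewrite /cell.
have -> : M%:R * (z.2 - z.1 * v0) / (v1 - v0) =
    M%:R * (z.2 - z.1 * v1) / (v1 - v0) + M%:R * z.1.
  by field; rewrite gt_eqF// subr_gt0.
set a := M%:R * (_ - _) / _.
have Mz : 0 <= M%:R * z.1 <= M%:R.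
  by case/andP: z01 => z0 z1; rewrite mulr_ge0// ler_piMr.
have aM : Num.floor (a + M%:R * z.1) <= Num.floor a + M%:Z.
  by apply: floor_le_add; rewrite -pmulrn; lra.
have a0 : Num.floor a <= Num.floor (a + M%:R * z.1).
  by rewrite -[leRHS]addr0; apply: floor_le_add; rewrite mulr0z; lra.
split; first by rewrite subr_ge0 a0 lerBlDl.
have := floor_itv a; have := floor_itv (a + M%:R * z.1).
by rewrite intrB !intrD; lra.
Qed.

Lemma floor_near (R : realType) (a b : R) : `|a - b| <= 1 ->
  [\/ Num.floor a = Num.floor b - 1, Num.floor a = Num.floor b |
      Num.floor a = Num.floor b + 1].
Proof.
rewrite ler_norml => ab.
have h1 : Num.floor a <= Num.floor b + 1 by apply: floor_le_add; rewrite mulr1z; lra.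
have h2 : Num.floor b <= Num.floor a + 1 by apply: floor_le_add; rewrite mulr1z; lra.
have [|e1] := eqVneq (Num.floor a) (Num.floor b - 1); first by constructor 1.
have [|e2] := eqVneq (Num.floor a) (Num.floor b); first by constructor 2.
by constructor 3; lia.
Qed.

(** The expression is nondecreasing in [p] and in [q]: replace [p] first, with coefficient
    [a - c * q], then [q], with coefficient [b - c * P]. *)
Lemma survival_le_step (R : realType) (a b c p q P : R) :
  0 <= p <= P -> 0 <= q <= P -> P <= 1 -> c <= a -> c <= b -> 0 <= c ->
  a * p + b * q - c * (p * q) <= a * P + b * P - c * (P * P).
Proof.
move=> pP qP P1 ca cb c0.
have h1 : 0 <= (a - c * q) * (P - p).
  by apply: mulr_ge0; [have : c * q <= c * 1 by (apply: ler_wpM2l => //; lra) | ]; lra.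
have h2 : 0 <= (b - c * P) * (P - q).
  by apply: mulr_ge0; [have : c * P <= c * 1 by (apply: ler_wpM2l => //; lra) | ]; lra.
lra.
Qed.

(** With [P = 10 / (n + 10)], the recursion gives at most [(1 + 2 / M) * P - P ^ 2 / 5]. The lower
    bound on [M] gives [2 / M <= P / 10], so this is at most [P - P ^ 2 / 10 <= 10 * P / (10 + P)],
    the bound at depth [n + 1]. *)
Lemma survival_upper (R : realType) (M n : nat) (k : R) (S : set R) (t : slope_tree R)
    (z : plane R) : 2 * (n%:R + 10) <= M%:R :> R ->
  well_spread k n S t -> 1 / 2 <= z.1 <= 1 ->
  survival M (near_side M) t z <= 10 / (n%:R + 10).
Proof.
move=> nM; have Mp : 0 < M%:R :> R by have := ler0n R n; lra.
have M0 : (0 < M)%N by rewrite ltr0n in Mp.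
elim: n S t nM => [|n IH] S [u|v0 v1 l r]//= nM.
  move=> _ _; rewrite mulr0n add0r divff//.
  by case/andP: (survival_bound (near_side M) (Leaf u) z M0).
move=> [v01 wl wr] z12.
have z01 : 0 <= z.1 <= 1 by lra.
rewrite survival_node//.
have [DM Dz] := cell_sub M v01 z01; move: DM Dz.
set A := cell M v0 _ z; set B := cell M v1 _ z => DM Dz.
set a := frequency _ _ _; set b := frequency _ _ (fun c => near_side M true (B + c)).
set c := frequency _ _ _.
move: nM; rewrite -(natr1 n); have n0 := ler0n R n; set N : R := n%:R => nM.
have a1 : a <= 1 / 2 + 1 / M%:R by exact: frequency_near_side.
have b1 : b <= 1 / 2 + 1 / M%:R by exact: frequency_near_side.
have ca : c <= a by apply: le_frequency => s /andP[].
have cb : c <= b by apply: le_frequency => s /andP[].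
(* Here [A - B >= M / 2 - 1] and [M >= 20], so that [(A - B) / (2 * M) >= 1 / 4 - 1 / 40]. *)
have c1 : 1 / 5 <= c.
  apply: (@le_trans _ _ ((A - B)%:~R / (2 * M%:R))).
    rewrite ler_pdivlMr; last by lra.
    have : 0 <= M%:R * (z.1 - 1 / 2) by apply: mulr_ge0; lra.
    by lra.
  rewrite -frequency_both//; apply: le_frequency => s /andP[sl sr].
  by rewrite /near_side sl sr !orbT.
have nM' : 2 * (N + 10) <= M%:R by lra.
have /andP[l0 _] := survival_bound (near_side M) l z M0.
have /andP[r0 _] := survival_bound (near_side M) r z M0.
have := IH _ _ nM' wl z12; have := IH _ _ nM' wr z12.
move: l0 r0; set p := survival _ _ l z; set q := survival _ _ r z; rewrite -/N.
set P := 10 / _ => p0 q0 qP pP.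
have P1 : P <= 1 by rewrite ler_pdivrMr; lra.
have P0 : 0 < P by rewrite divr_gt0//; lra.
have MP : 2 / M%:R <= P / 10.
  rewrite /P mulrAC divff// ler_pdivrMr// mulrC mulrA ler_pdivlMr; lra.
have PE : 10 / (N + 1 + 10) = 10 * P / (10 + P).
  rewrite /P; field; apply/and3P.
  by split; apply: lt0r_neq0; lra.
apply: (@le_trans _ _ (10 * P / (10 + P))); last by rewrite -PE; exact: lexx.
move: P P1 P0 MP qP pP {PE} => P P1 P0 MP qP pP.
apply: (@le_trans _ _ (a * P + b * P - c * (P * P))).
  by apply: survival_le_step => //; rewrite ?p0 ?q0//; lra.
apply: (@le_trans _ _ ((1 + 2 / M%:R) * P - (1 / 5) * (P * P))).
  have : 0 <= (1 / 2 + 1 / M%:R - a) * P by apply: mulr_ge0; lra.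
  have : 0 <= (1 / 2 + 1 / M%:R - b) * P by apply: mulr_ge0; lra.
  have : 0 <= (c - 1 / 5) * (P * P).
    by apply: mulr_ge0; [lra|exact: mulr_ge0 (ltW P0) (ltW P0)].
  by lra.
rewrite ler_pdivlMr; last by lra.
have h1 : 0 <= (P / 10 - 2 / M%:R) * P by apply: mulr_ge0; lra.
have h2 : 0 <= (P / 10 - 2 / M%:R) * (P * P).
  by apply: mulr_ge0; [lra|exact: mulr_ge0 (ltW P0) (ltW P0)].
have h3 : 0 <= P * (P * P) by apply: mulr_ge0; [lra|exact: mulr_ge0 (ltW P0) (ltW P0)].
by lra.
Qed.

(** The term [1 / M] pays for rounding: with [y = z.1 + 1 / M] the overlap satisfies [c <= y / 2],
    besides [c <= 1 / 2]. With [s = 1 + n * y], these two bounds give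
    [1 / s - c / s ^ 2 >= 1 / (s + y)]. *)
Lemma survival_lower (R : realType) (M n : nat) (k : R) (S : set R) (t : slope_tree R)
    (z : plane R) : (0 < M)%N -> well_spread k n S t -> 0 <= z.1 <= 1 ->
  1 / (1 + n%:R * (z.1 + 1 / M%:R)) <= survival M (side M) t z.
Proof.
move=> M0; elim: n S t => [|n IH] S [u|v0 v1 l r]//=.
  move=> _ _; rewrite mul0r addr0 divr1 /survival.
  by rewrite (eq_mean (g := fun=> 1))// mean1// card_unit.
move=> [v01 wl wr] z01.
rewrite survival_node//.
have [DM Dz] := cell_sub M v01 z01; move: DM Dz.
set A := cell M v0 _ z; set B := cell M v1 _ z => DM Dz.
have Mp : 0 < M%:R :> R by rewrite ltr0n.
rewrite !frequency_side// frequency_both//; set c := _%:~R / _.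
have c0 : 0 <= c by rewrite /c divr_ge0// ?mulr_ge0// ler0z; case/andP: DM.
have c1 : c <= 1 / 2.
  rewrite ler_pdivrMr ?mulr_gt0// mulrA divfK// mul1r.
  by rewrite -[leRHS]/((M%:Z)%:~R) ler_int; case/andP: DM.
set y := z.1 + 1 / M%:R.
have cy : c <= y / 2.
  rewrite ler_pdivrMr ?mulr_gt0// mulrA divfK// mulrDl divfK ?gt_eqF// [z.1 * _]mulrC.
  by lra.
have y0 : 0 <= y by rewrite addr_ge0 ?divr_ge0//; lra.
have /andP[_ l1] := survival_bound (side M) l z M0.
have /andP[_ r1] := survival_bound (side M) r z M0.
have := IH _ _ wl z01; have := IH _ _ wr z01.
move: l1 r1; set p := survival _ _ l z; set q := survival _ _ r z; rewrite -/y.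
set s := 1 + n%:R * y => p1 q1 sq sp.
have s1 : 1 <= s by rewrite lerDl mulr_ge0.
have i0 : 0 < 1 / s by rewrite divr_gt0//; lra.
apply: (@le_trans _ _ (1 / s - c * (1 / s * (1 / s)))); last first.
  have h1 : 0 <= (1 / 2 - c * q) * (p - 1 / s).
    by apply: mulr_ge0; [have : c * q <= c * 1 by (apply: ler_wpM2l => //; lra) | ]; lra.
  have h2 : 0 <= (1 / 2 - c * (1 / s)) * (q - 1 / s).
    by apply: mulr_ge0;
      [have : c * (1 / s) <= c * 1 by (apply: ler_wpM2l => //; lra) | ]; lra.
  lra.
have -> : 1 + n.+1%:R * y = s + y by rewrite -[n.+1%:R]natr1 mulrDl mul1r addrA.
have -> : 1 / s - c * (1 / s * (1 / s)) = (s - c) / (s * s) by field; lra.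
rewrite ler_pdivrMr; last by lra.
rewrite mulrAC ler_pdivlMr; last by rewrite mulr_gt0//; lra.
have h1 : 0 <= (y / 2 - c) * s by apply: mulr_ge0; lra.
have h2 : 0 <= y * (s / 2 - c) by apply: mulr_ge0; lra.
lra.
Qed.

(** * Stability of survival along a strip *)

Lemma near_side_floor (R : realType) (M : nat) (b : bool) (x y : R) (s : int) :
  `|x - y| <= 1 -> side M b (Num.floor x + s) -> near_side M b (Num.floor y + s).
Proof.
by move=> /floor_near[] ->; rewrite ?[_ + _ + s]addrAC /near_side => ->; rewrite ?orbT.
Qed.

(** The error in slope, over a horizontal distance at most one, and the deviation from the line each
    contribute at most half a cell. *)
Lemma cell_strip (R : realType) (M : nat) (v d u x0 y0 x y : R) :
  (0 < M)%N -> 0 < d -> `|u - v| <= 1 / (2 * M%:R) * d ->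
  `|x0 - x| <= 1 -> `|y - y0 - u * (x - x0)| <= 1 / (2 * M%:R) * d ->
  `|M%:R * (y0 - x0 * v) / d - M%:R * (y - x * v) / d| <= 1.
Proof.
move=> M0 d0 uv xx st; have Mp : 0 < M%:R :> R by rewrite ltr0n.
have -> : M%:R * (y0 - x0 * v) / d - M%:R * (y - x * v) / d =
    M%:R / d * ((x0 - x) * (u - v) - (y - y0 - u * (x - x0))).
  by field; rewrite gt_eqF.
rewrite normrM gtr0_norm ?divr_gt0// mulrAC ler_pdivrMr// mul1r mulrC -ler_pdivlMr//.
apply: (le_trans (ler_normB _ _)); rewrite normrM.
apply: (@le_trans _ _ (1 * (1 / (2 * M%:R) * d) + 1 / (2 * M%:R) * d)).
  by apply: lerD => //; exact: ler_pM.
by rewrite le_eqVlt; apply/orP; left; apply/eqP; field; rewrite gt_eqF.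
Qed.

(* The slope of a leaf is so close to the approximate slopes at its ancestors that, along
   its line, each index moves by at most one cell; [near_side] absorbs this. *)
Lemma survives_strip (R : realType) (M n : nat) (S : set R) (t : slope_tree R)
    (om : sample M t) (z0 : plane R) :
  (0 < M)%N -> well_spread (1 / (2 * M%:R)) n S t -> 0 <= z0.1 <= 1 ->
  survives (side M) om z0 ->
  exists u e, [/\ S u, 0 < e &
    forall z : plane R, 0 <= z.1 <= 1 -> `|z.2 - z0.2 - u * (z.1 - z0.1)| <= e ->
      survives (near_side M) om z].
Proof.
move=> M0; elim: n S t om => [|n IH] S [u|v0 v1 l r]//= om.
  by move=> Su _ _; exists u, 1; split.
move=> [v01 wl wr] z01 /orP[]/andP[sd sub].
  have [u [e [[Su uv] e0 he]]] := IH _ _ _ wl z01 sub.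
  (* The half-thickness of the strip is also limited to half a cell of the grid at this node. *)
  exists u, (Num.min e (1 / (2 * M%:R) * (v1 - v0))); split => //.
    by rewrite lt_min e0 mulr_gt0 ?subr_gt0// divr_gt0// mulr_gt0 ?ltr0n.
  move=> z zx; rewrite le_min => /andP[ze zv]; apply/orP; left; rewrite he// andbT.
  apply: near_side_floor sd; apply: cell_strip uv _ zv => //; first by rewrite subr_gt0.
  by rewrite ler_norml; lra.
have [u [e [[Su uv] e0 he]]] := IH _ _ _ wr z01 sub.
exists u, (Num.min e (1 / (2 * M%:R) * (v1 - v0))); split => //.
  by rewrite lt_min e0 mulr_gt0 ?subr_gt0// divr_gt0// mulr_gt0 ?ltr0n.
move=> z zx; rewrite le_min => /andP[ze zv]; apply/orP; right; rewrite he// andbT.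
apply: near_side_floor sd; apply: cell_strip uv _ zv => //; first by rewrite subr_gt0.
by rewrite ler_norml; lra.
Qed.

Lemma measurable_cell (R : realType) (M : nat) (v d : R) (phi : int -> bool) :
  measurable [set z : plane R | phi (cell M v d z)].
Proof.
have mg : measurable_fun [set: plane R] (fun z => M%:R * (z.2 - z.1 * v) / d).
  apply: measurable_funM; last exact: measurable_cst.
  apply: measurable_funM; first exact: measurable_cst.
  apply: measurable_funB; first exact: measurable_snd.
  by apply: measurable_funM; [exact: measurable_fst|exact: measurable_cst].
have -> : [set z : plane R | phi (cell M v d z)] =
    \bigcup_(c in [set c | phi c])
      ((fun z => M%:R * (z.2 - z.1 * v) / d) @^-1` `[c%:~R, (c + 1)%:~R[).
  apply/seteqP; split => z /=.
    by move=> h; exists (cell M v d z) => //=; rewrite in_itv; exact: floor_itv.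
  move=> [c /= pc]; rewrite in_itv /= => /floor_def fE.
  by rewrite /cell fE.
rewrite bigcup_mkcond; apply: countable_bigcupT_measurable; first exact: countableP.
move=> c; case: ifP => _; last exact: measurable0.
by rewrite -[X in measurable X]setTI; apply: mg => //; exact: measurable_itv.
Qed.

Lemma measurable_survives (R : realType) (M : nat) (phi : bool -> int -> bool)
    (t : slope_tree R) (om : sample M t) :
  measurable [set z : plane R | survives phi om z].
Proof.
elim: t om => [u|v0 v1 l IHl r IHr] om /=; first by rewrite set_true.
have -> : [set z : plane R | survives phi (om : sample M (Node v0 v1 l r)) z] =
  ([set z | phi false (cell M v0 (v1 - v0) z + (om.1 : nat)%:Z)] `&`
   [set z | survives phi om.2.1 z]) `|`
  ([set z | phi true (cell M v1 (v1 - v0) z + (om.1 : nat)%:Z)] `&`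
   [set z | survives phi om.2.2 z]).
  apply/seteqP; split => z /=.
    by move=> /orP[]/andP[]; [left|right].
  by move=> [[-> ->]|[-> ->]]; rewrite ?orbT.
apply: measurableU; apply: measurableI => //.
- exact: (@measurable_cell _ _ _ _ (fun c => phi false (c + _))).
- exact: (@measurable_cell _ _ _ _ (fun c => phi true (c + _))).
Qed.

(** * The maximal operator on strips *)

Lemma measurable_slab (R : realType) (a b c e : R) :
  measurable [set z : plane R | `|z.1 * a + z.2 * b + c| < e].
Proof.
have mg : measurable_fun [set: plane R] (fun z => z.1 * a + z.2 * b + c).
  apply: measurable_funD; last exact: measurable_cst.
  apply: measurable_funD; apply: measurable_funM; try exact: measurable_cst.
    exact: measurable_fst.
  exact: measurable_snd.
have -> : [set z : plane R | `|z.1 * a + z.2 * b + c| < e] =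
    (fun z => z.1 * a + z.2 * b + c) @^-1` `]- e, e[.
  by apply/seteqP; split => z /=; rewrite in_itv /= ltr_norml.
by rewrite -[X in measurable X]setTI; apply: mg => //; exact: measurable_itv.
Qed.

Definition strip (R : realType) (u : R) (z0 : plane R) (e : R) : set (plane R) :=
  [set z | `|z.2 - z0.2 - u * (z.1 - z0.1)| < e].

Lemma stripE (R : realType) (u : R) (z0 : plane R) (e : R) :
  strip u z0 e = [set z : plane R | `|z.1 * - u + z.2 * 1 + (u * z0.1 - z0.2)| < e].
Proof.
by apply/seteqP; split => z; rewrite /strip /=; congr (`|_| < _); ring.
Qed.

Lemma measurable_vertical (R : realType) (i : interval R) :
  measurable [set z : plane R | z.1 \in i].
Proof.
rewrite -[X in measurable X]setTI.
exact: (@measurable_fst _ _ (measurableTypeR R) (measurableTypeR R) measurableT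
  [set` i] (measurable_itv i)).
Qed.

(** Cavalieri: each vertical section over [i] is an interval of length [2 * e], whatever the
    slope. *)
Lemma lebesgue2_strip (R : realType) (i : interval R) (u : R) (z0 : plane R) (e : R) :
  0 < e ->
  lebesgue2 R ([set z | z.1 \in i] `&` strip u z0 e) =
  ((2 * e)%:E * @lebesgue_measure R [set` i])%E.
Proof.
move=> e0; rewrite -[LHS]/(\int[lebesgue_measure]_x (lebesgue_measure \o
  xsection ([set z | z.1 \in i] `&` strip u z0 e)) x)%E.
transitivity (\int[@lebesgue_measure R]_x ((2 * e)%:E * (\1_[set` i] x)%:E))%E.
  apply: eq_integral => x _ /=; rewrite indicE.
  have [xi|xi] := boolP (x \in i); last first.
    rewrite memNset/= ?mule0; last exact/negP.
    rewrite (_ : xsection _ _ = set0) ?measure0//.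
    apply/seteqP; split => y //; rewrite /xsection /= inE => -[/=].
    by rewrite (negbTE xi).
  rewrite mem_set//= mule1.
  rewrite (_ : xsection _ _ =
      `]z0.2 + u * (x - z0.1) - e, z0.2 + u * (x - z0.1) + e[%classic).
    rewrite lebesgue_measure_itv/= lte_fin ifT; last by lra.
    by rewrite -EFinB; congr _%:E; lra.
  apply/seteqP; split => y; rewrite /xsection /= inE in_itv /strip /= ltr_norml.
    by move=> [_]; lra.
  by move=> h; split => //; lra.
rewrite ge0_integralZl//=; first by rewrite integral_indic// setIT.
- by apply/measurable_EFinP; exact: measurable_indic.
- have : 0 <= 2 * e by lra.
  by rewrite lee_fin.
Qed.

(** A rectangle centred at [z0] along the strip contains the piece of the strip over [[1 / 2, 1]],
    of area [e], and lies in the piece over an interval of length 10, of area [20 * e]. *)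
Lemma maximal_op_ge (R : realType) (Om : set (plane R)) (F : set (plane R))
    (u e : R) (z0 : plane R) :
  Om `<=` unit_circle R -> slopes Om u -> measurable F -> 0 < e <= 1 ->
  0 <= z0.1 <= 1 / 2 ->
  [set z | z.1 \in `[1 / 2, 1]] `&` strip u z0 e `<=` F ->
  ((1 / 20)%:E <= maximal_op Om (\1_F) z0)%E.
Proof.
move=> circ [u01 [w Omw [t _ [tw1 tw2]]]] mF e01 z00 sF.
have {}circ : w.1 ^+ 2 + w.2 ^+ 2 = 1 := circ _ Omw.
have w2E : w.2 = u * w.1 by rewrite -tw2 mulrAC tw1 mul1r.
have w10 : w.1 != 0 by apply: contra_eq_neq tw1 => ->; rewrite mulr0 eq_sym oner_eq0.
have aw1 : 0 < `|w.1| by rewrite normr_gt0.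
have w11 : `|w.1| <= 1.
  by rewrite -(@ler_pXn2r _ 2)// ?nnegrE// expr1n
    real_normK ?num_real// -circ lerDl sqr_ge0.
have w21 : `|w.2| <= 1.
  by rewrite -(@ler_pXn2r _ 2)// ?nnegrE// expr1n
    real_normK ?num_real// -circ lerDr sqr_ge0.
move: u01; rewrite in_itv /= => u01.
(* The factor [|w.1|] converts the vertical thickness [2 * e] into a width. The half-length 4
   exceeds 3, the bound obtained below for the displacement along [w] from [z0] to a point of
   [Q]. *)
set A := rectangle z0 w 8 (2 * e * `|w.1|).
have rA : directional_rectangles Om A.
  exists w, z0, 8, (2 * e * `|w.1|); split => //.
    by rewrite !mulr_gt0//; lra.
  apply: (@le_trans _ _ (2 * 1)); last by lra.
  by rewrite ler_pM//; lra.
have Az0 : A z0.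
  rewrite /A /rectangle /= !subrr !mul0r addr0 subr0 normr0; split; first by lra.
  by rewrite divr_gt0// !mulr_gt0//; lra.
have perp z : (z.2 - z0.2) * w.1 - (z.1 - z0.1) * w.2 =
    (z.2 - z0.2 - u * (z.1 - z0.1)) * w.1 by rewrite w2E; ring.
have width : 2 * e * `|w.1| / 2 = e * `|w.1| by field.
have stripA z : `|(z.2 - z0.2) * w.1 - (z.1 - z0.1) * w.2| < 2 * e * `|w.1| / 2 <->
    strip u z0 e z.
  by rewrite perp width normrM ltr_pM2r.
pose P := [set z : plane R | z.1 \in `]z0.1 - 5, z0.1 + 5[] `&` strip u z0 e.
pose Q := [set z : plane R | z.1 \in `[1 / 2, 1]] `&` strip u z0 e.
have mstrip : measurable (strip u z0 e) by rewrite stripE; exact: measurable_slab.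
have mP : measurable P by apply: measurableI => //; exact: measurable_vertical.
have mQ : measurable Q by apply: measurableI => //; exact: measurable_vertical.
have AP : A `<=` P.
  move=> z [along across]; split; last exact/stripA.
  (* Expand the displacement in the orthonormal frame given by [w] and its rotation; the two terms
     are below 4 and 1. *)
  have dx : z.1 - z0.1 = w.1 * ((z.1 - z0.1) * w.1 + (z.2 - z0.2) * w.2) -
      w.2 * ((z.2 - z0.2) * w.1 - (z.1 - z0.1) * w.2).
    by rewrite -[LHS]mulr1 -circ; ring.
  suff : `|z.1 - z0.1| < 5 by rewrite ltr_norml /= in_itv /=; lra.
  rewrite dx; apply: (le_lt_trans (ler_normB _ _)); rewrite !normrM.
  have h1 := ler_wpM2r (normr_ge0 ((z.1 - z0.1) * w.1 + (z.2 - z0.2) * w.2)) w11.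
  have h2 := ler_wpM2r (normr_ge0 ((z.2 - z0.2) * w.1 - (z.1 - z0.1) * w.2)) w21.
  have h3 : e * `|w.1| <= 1 * 1 by rewrite ler_pM//; lra.
  by rewrite width in across; lra.
have QA : Q `<=` A.
  move=> z [zx zs]; split; last exact/stripA.
  move: zx zs; rewrite /strip /= in_itv /= => zx zs.
  apply: (le_lt_trans (ler_normD _ _)); rewrite !normrM.
  have d1 : `|z.1 - z0.1| <= 1 by rewrite ler_norml; lra.
  have d2 : `|u * (z.1 - z0.1)| <= 1.
    by rewrite normrM -[leRHS]mulr1 ler_pM// ger0_norm; lra.
  have d3 : `|z.2 - z0.2| <= 2.
    by rewrite -[z.2 - _](subrK (u * (z.1 - z0.1)));
      apply: (le_trans (ler_normD _ _)); lra.
  have h1 : `|z.1 - z0.1| * `|w.1| <= 1 * 1 by exact: ler_pM.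
  have h2 : `|z.2 - z0.2| * `|w.2| <= 2 * 1 by exact: ler_pM.
  lra.
have mA : measurable A.
  rewrite /A (_ : rectangle _ _ _ _ = [set z : plane R |
      `|z.1 * w.1 + z.2 * w.2 + - (z0.1 * w.1 + z0.2 * w.2)| < 8 / 2] `&` strip u z0 e).
    by apply: measurableI => //; exact: measurable_slab.
  apply/seteqP; split => z [az bz]; split; try exact/stripA.
    by move: az; rewrite /=; congr (`|_| < _); ring.
  by move: az; rewrite /=; congr (`|_| < _); ring.
have lP : lebesgue2 R P = (20 * e)%:E.
  rewrite lebesgue2_strip; last by lra.
  rewrite lebesgue_measure_itv/= lte_fin ifT; last by lra.
  by rewrite -EFinB -EFinM; congr _%:E; ring.
have lQ : lebesgue2 R Q = e%:E.
  rewrite lebesgue2_strip; last by lra.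
  rewrite lebesgue_measure_itv/= lte_fin ifT; last by lra.
  by rewrite -EFinB -EFinM; congr _%:E; field.
have lAP : (lebesgue2 R A <= (20 * e)%:E)%E by rewrite -lP le_measure ?inE.
have lQA : (e%:E <= lebesgue2 R A)%E by rewrite -lQ le_measure ?inE.
apply: (le_trans _ (ereal_sup_ubound _)); last by exists A.
have -> : (\int[lebesgue2 R]_(y in A) `|\1_F y|%:E)%E = lebesgue2 R (F `&` A).
  rewrite -integral_indic//; apply: eq_integral => z _.
  by rewrite ger0_norm.
have lFA : (e%:E <= lebesgue2 R (F `&` A))%E.
  rewrite -lQ le_measure ?inE//; first exact: measurableI.
  by move=> z Qz; split; [exact: sF|exact: QA].
(* The area of [A] is finite and positive, so the quotient of extended reals is a genuine one. *)
move: lAP lQA; case: (lebesgue2 R A) => [r| |]//; rewrite !lee_fin => rle ler.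
rewrite inver gt_eqF; last by lra.
rewrite lee_pdivlMr; last by lra.
by apply: le_trans lFA; rewrite -EFinM lee_fin; lra.
Qed.

(* No measurability of [g] is needed: the integral of a nonnegative function is a
   supremum over simple functions. *)
Lemma mul_measure_le_integral (d : measure_display) (T : measurableType d)
    (R : realType) (mu : {measure set T -> \bar R}) (E : set T) (c : R)
    (g : T -> \bar R) : measurable E -> 0 <= c -> (forall x, 0 <= g x)%E ->
  (forall x, E x -> c%:E <= g x)%E -> (c%:E * mu E <= \int[mu]_x g x)%E.
Proof.
move=> mE c0 g0 cg.
have -> : (c%:E * mu E = \int[mu]_x (scale_nnsfun (indic_nnsfun R mE) c0 x)%:E)%E.
  rewrite -[E in mu E]setIT -integral_indic// -ge0_integralZl//=.
  - by apply/measurable_EFinP; exact: measurable_indic.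
rewrite integral_nnsfun// patch_setT ge0_integralTE//.
apply: ereal_sup_ubound; exists (scale_nnsfun (indic_nnsfun R mE) c0) => //= x.
rewrite -[X in (X%:E <= _)%E]/(c * \1_E x) indicE.
have [xE|xE] := boolP (x \in E); last by rewrite mulr0.
by rewrite mulr1; apply: cg; rewrite inE in xE.
Qed.

(** * Norms of indicators and the weak-type inequality *)

Lemma poweR_Lnorm_indic (d : measure_display) (T : measurableType d)
    (R : realType) (mu : {measure set T -> \bar R}) (F : set T) (p : R) :
  measurable F -> 0 < p -> ('N[mu]_p%:E[EFin \o \1_F] `^ p = mu F)%E.
Proof.
move=> mF p0; rewrite poweR_Lnorm ?gt_eqF// -[F in RHS]setIT -integral_indic//.
apply: eq_integral => x _ /=; rewrite ger0_norm// indicE.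
by case: (x \in F); rewrite ?powR1 ?powR0 ?gt_eqF.
Qed.

Lemma indic_Lfun (d : measure_display) (T : measurableType d)
    (R : realType) (mu : {measure set T -> \bar R}) (F : set T) (p : R) :
  measurable F -> (mu F < +oo)%E -> 0 < p -> \1_F \in Lfun mu p%:E.
Proof.
move=> mF muF p0; rewrite inE /= /Lfun; apply/andP; split; rewrite inE /=.
  exact: measurable_indic.
rewrite /finite_norm; apply: (@lty_poweRy _ _ p); first by rewrite gt_eqF.
by rewrite poweR_Lnorm_indic.
Qed.

(** Chebyshev's inequality at level [1 / 20]. Passing from [C] to [|C|] keeps both sides
    nonnegative, where powers are monotone. *)
Lemma maximal_measure_le (R : realType) (Om : set (plane R)) (p C : R)
    (E F : set (plane R)) : 1 <= p ->
  (forall f : plane R -> R, f \in Lfun (lebesgue2 R) p%:E ->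
      ('N[lebesgue2 R]_(p%:E)[maximal_op Om f] <=
       C%:E * 'N[lebesgue2 R]_(p%:E)[EFin \o f])%E) ->
  measurable E -> measurable F -> (lebesgue2 R F < +oo)%E ->
  (forall z, E z -> (1 / 20)%:E <= maximal_op Om (\1_F) z)%E ->
  (lebesgue2 R E <= ((20 * `|C|) `^ p)%:E * lebesgue2 R F)%E.
Proof.
move=> p1 bound mE mF finF EM; have p0 : 0 < p by lra.
have pn0 : p != 0 by rewrite gt_eqF.
have c0 : 0 < (1 / 20 : R) by lra.
have h : (((1 / 20) `^ p)%:E * lebesgue2 R E <= (`|C| `^ p)%:E * lebesgue2 R F)%E.
  apply: (@le_trans _ _ ('N[lebesgue2 R]_(p%:E)[maximal_op Om (\1_F)] `^ p)%E).
    rewrite poweR_Lnorm//; apply: mul_measure_le_integral => //.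
    - by move=> x; exact: poweR_ge0.
    - move=> x /EM Mx; rewrite -poweR_EFin; apply: gt0_ler_poweR.
      + exact: ltW.
      + by rewrite in_itv /= leey andbT lee_fin ltW.
      + by rewrite in_itv /= leey andbT.
      + by apply: (le_trans Mx); exact: lee_abs.
  apply: (@le_trans _ _ ((`|C|%:E * 'N[lebesgue2 R]_(p%:E)[EFin \o \1_F]) `^ p)%E).
    apply: gt0_ler_poweR; first exact: ltW.
    - by rewrite in_itv /= leey andbT Lnorm_ge0.
    - by rewrite in_itv /= leey andbT mule_ge0// Lnorm_ge0.
    - apply: (le_trans (bound _ (indic_Lfun mF finF p0))).
      by apply: lee_wpmul2r; [exact: Lnorm_ge0|rewrite lee_fin ler_norm].
  by rewrite poweRM// ?Lnorm_ge0// poweR_EFin poweR_Lnorm_indic.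
have q0 : 0 < (1 / 20 : R) `^ p by rewrite powR_gt0.
have inv : 20 `^ p * (1 / 20) `^ p = 1 :> R.
  by rewrite -powRM; [rewrite (_ : 20 * _ = 1) ?powR1//; lra|lra|lra].
have -> : (20 * `|C|) `^ p = ((1 / 20) `^ p)^-1 * `|C| `^ p.
  by rewrite powRM// (canRL (mulfK (lt0r_neq0 q0)) inv) [1 / _ `^ _]div1r.
rewrite EFinM -muleA.
by rewrite lee_pdivlMl.
Qed.

(** * Averaging over the outcomes *)

(** Exchanging sum and integral turns pointwise survival probabilities into expected areas. *)
Lemma sum_measureE (d : measure_display) (T : measurableType d) (R : realType)
    (mu : {measure set T -> \bar R}) (I : finType) (E : I -> set T) (B : set T) :
  (forall i, measurable (E i)) -> measurable B ->
  (\sum_i mu (E i `&` B) = \int[mu]_(x in B) (\sum_i \1_(E i) x)%:E)%E.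
Proof.
move=> mE mB; under eq_bigr do rewrite -integral_indic//.
rewrite -ge0_integral_sum//; first by under eq_integral do rewrite sumEFin.
- by move=> i; apply/measurable_EFinP; exact: measurable_indic.
Qed.

Lemma sum_measure_le (d : measure_display) (T : measurableType d) (R : realType)
    (mu : {measure set T -> \bar R}) (I : finType) (E : I -> set T) (B : set T) (k : R) :
  (forall i, measurable (E i)) -> measurable B ->
  (forall x, B x -> \sum_i \1_(E i) x <= k) ->
  (\sum_i mu (E i `&` B) <= k%:E * mu B)%E.
Proof.
move=> mE mB h; rewrite sum_measureE// -integral_cst//; apply: ge0_le_integral => //.
- by move=> x _; rewrite lee_fin sumr_ge0.
- by apply/measurable_EFinP; apply: measurable_sum => i; exact: measurable_indic.
Qed.

Lemma sum_measure_ge (d : measure_display) (T : measurableType d) (R : realType)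
    (mu : {measure set T -> \bar R}) (I : finType) (E : I -> set T) (B : set T) (k : R) :
  (forall i, measurable (E i)) -> measurable B -> 0 <= k ->
  (forall x, B x -> k <= \sum_i \1_(E i) x) ->
  (k%:E * mu B <= \sum_i mu (E i `&` B))%E.
Proof.
move=> mE mB k0 h; rewrite sum_measureE// -integral_cst//; apply: ge0_le_integral => //.
- by apply/measurable_EFinP; apply: measurable_sum => i; exact: measurable_indic.
Qed.

Lemma sum_indic_survives (R : realType) (M : nat) (phi : bool -> int -> bool)
    (t : slope_tree R) (z : plane R) : (0 < M)%N ->
  \sum_(om : sample M t) \1_[set z | survives phi om z] z =
  survival M phi t z * #|sample M t|%:R.
Proof.
move=> M0; rewrite /survival /mean divfK; last first.
  by rewrite pnatr_eq0 -lt0n; exact: card_sample.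
by apply: eq_bigr => om _; rewrite indicE; congr (_%:R); rewrite mem_setE.
Qed.

Lemma lebesgue2_box (R : realType) (a b c d : R) (ab cd : bool) : a < b -> c < d ->
  lebesgue2 R ([set` Interval (BLeft a) (BSide ab b)] `*`
    [set` Interval (BLeft c) (BSide cd d)]) = ((b - a) * (d - c))%:E.
Proof.
move=> lab lcd; rewrite -[LHS]/((lebesgue_measure \x lebesgue_measure)%E (_ `*` _)).
rewrite product_measure1E//; try exact: measurable_itv.
rewrite EFinM; congr (_ * _)%E; apply: etrans (lebesgue_measure_itv _) _ => /=.
  by rewrite lte_fin lab -EFinB.
by rewrite lte_fin lcd -EFinB.
Qed.
(** The abscissa varies by a factor of at most 2 on a shell, so a single lower bound on the survival
    probability serves for all of it. *)
Definition dyadic_shell (R : realType) (j : nat) : set (plane R) :=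
  [set` `[2 ^- j.+2, 2 ^- j.+1[] `*` [set` `[0, 1]].

Lemma trivIset_dyadic_shell (R : realType) : trivIset [set: nat] (@dyadic_shell R).
Proof.
apply: ltn_trivIset => n m mn; rewrite -subset0 => -[x y] [[/= + _] [/= + _]].
rewrite !in_itv /= => /andP[h1 _] /andP[_ h2].
have : 2 ^- n.+1 <= 2 ^- m.+2 :> R.
  by rewrite lef_pV2 ?posrE ?exprn_gt0// ler_weXn2l// ler1n.
lra.
Qed.

(* With [n = 2 ^ J.+1]: the shell has area [2 ^- j.+2], so that each of the [log n]
   shells keeps an expected area [1 / (4 * n)], comparable to that of the far box. *)
Lemma survival_shell (R : realType) (J M : nat) (S : set R) (k : R) (t : slope_tree R)
    (j : nat) (z : plane R) : (0 < M)%N -> (2 ^ J.+1 <= M)%N -> (j < J)%N ->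
  well_spread k (2 ^ J.+1) S t -> dyadic_shell j z ->
  2 ^+ j / 2 ^+ J.+1 <= survival M (side M) t z.
Proof.
move=> M0 nM jJ wt [/=]; rewrite !in_itv /= => /andP[z1 z2] _.
have pj : 0 < 2 ^+ j :> R by exact: exprn_gt0.
have pJ : 0 < 2 ^+ J.+1 :> R by exact: exprn_gt0.
have Mp : 0 < M%:R :> R by rewrite ltr0n.
have z01 : 0 <= z.1 <= 1.
  have : 0 <= 2 ^- j.+2 :> R by rewrite invr_ge0 exprn_ge0.
  have : 2 ^- j.+1 <= 1 :> R by rewrite invf_le1 ?exprn_gt0// exprn_ege1// ler1n.
  lra.
apply: le_trans (survival_lower M0 wt z01); rewrite natrX.
have -> : 2 ^+ j / 2 ^+ J.+1 = 1 / (2 ^+ J.+1 / 2 ^+ j) :> R by field; rewrite !gt_eqF.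
(* Since [j < J], the ratio [r = 2 ^ J.+1 / 2 ^ j] is at least 4, which lets [1 + r / 2 + 1 <= r]
   close the estimate. *)
have nj : 4 <= 2 ^+ J.+1 / 2 ^+ j :> R.
  rewrite ler_pdivlMr// -natrX -natrM -natrX ler_nat -(expnD 2 2) leq_exp2l//.
have nM' : 2 ^+ J.+1 / M%:R <= 1 :> R.
  by rewrite ler_pdivrMr// mul1r -natrX ler_nat.
have nz : 2 ^+ J.+1 * z.1 <= 2 ^+ J.+1 / 2 ^+ j / 2.
  by rewrite -mulrA -invfM -exprSr ler_pM2l// ltW.
have nz0 : 0 <= 2 ^+ J.+1 * z.1 by rewrite mulr_ge0//; lra.
have nM0 : 0 <= 2 ^+ J.+1 / M%:R :> R by rewrite divr_ge0.
rewrite mulrDr mulrA mulr1 !div1r lef_pV2 ?posrE; lra.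
Qed.

(** From a height in [[0, 1]], a slope in [[0, 1]] over a distance at most 1 and a deviation at most
    1 lead to heights in [[- 2, 3]]. *)
Definition far_box (R : realType) : set (plane R) :=
  [set` `[1 / 2, 1]] `*` [set` `[- 2, 3]].

Lemma survives_maximal_op_ge (R : realType) (Om : set (plane R)) (M n : nat)
    (t : slope_tree R) (om : sample M t) (z : plane R) :
  (0 < M)%N -> Om `<=` unit_circle R ->
  well_spread (1 / (2 * M%:R)) n (slopes Om) t ->
  0 <= z.1 <= 1 / 2 -> 0 <= z.2 <= 1 -> survives (side M) om z ->
  ((1 / 20)%:E <= maximal_op Om (\1_([set z' | survives (near_side M) om z'] `&`
    @far_box R)) z)%E.
Proof.
move=> M0 circ wt z1 z2 sz.
have z01 : 0 <= z.1 <= 1 by lra.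
have [u [e [Su e0 he]]] := survives_strip M0 wt z01 sz.
(* The cap at 1 keeps the strip inside the far box and meets the bound on [e] in [maximal_op_ge]. *)
have e1 : 0 < Num.min e 1 by rewrite lt_min e0 ltr01.
have e1' : 0 < Num.min e 1 <= 1 by rewrite e1 ge_min lexx orbT.
apply: (maximal_op_ge circ Su _ e1' z1).
- apply: measurableI; first exact: measurable_survives.
  by apply: measurableX; exact: measurable_itv.
move=> z' [/=]; rewrite in_itv /= => z1'.
rewrite /strip /= lt_min => /andP[ze zs]; split; first by apply: he; [lra|exact: ltW].
have [u01 _] := Su; move: u01; rewrite in_itv /= => u01.
split; rewrite /= in_itv //=.
have : `|u * (z'.1 - z.1)| <= 1.
  by rewrite normrM -[leRHS]mulr1 ler_pM// ler_norml; lra.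
move: zs; rewrite ltr_norml ler_norml; lra.
Qed.

Theorem theorem1 (R : realType) (Om : set (plane R))
  (Om_circle : Om `<=` unit_circle R)
  (Om_nonempty : Om !=set0)
  (Om_slopes : forall w, Om w -> origin_line w `&` slope_segment R !=set0)
  (Om_lacunary : exists2 eta : R, 0 < eta &
     forall N : nat, exists T : set vertex,
       [/\ T `<=` direction_tree Om, subtree T, eta_separated eta T & lacunary N T])
  (p : R) (p_ge1 : 1 <= p) :
  ~ exists C : R, forall f : plane R -> R, f \in Lfun (lebesgue2 R) p%:E ->
      ('N[lebesgue2 R]_(p%:E)[maximal_op Om f] <=
       C%:E * 'N[lebesgue2 R]_(p%:E)[EFin \o f])%E.
Proof.
move=> [C bound]; set K := (20 * `|C|) `^ p.
have K0 : 0 <= K by exact: powR_ge0.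
(* The final comparison gives [J * (N / (4 * n)) <= 25 * K * N / n], which [J > 100 * K]
   contradicts. *)
have [J KJ] : exists J, 100 * K < J%:R.
  by exists (Num.truncn (100 * K)).+1; exact: truncnS_gt.
have [n nE] : exists n, n = (2 ^ J.+1)%N by exists (2 ^ J.+1)%N.
have [M [M0 nM M2]] : exists M, [/\ (0 < M)%N, (n <= M)%N & 2 * (n%:R + 10) <= M%:R :> R].
  exists (2 * (n + 10))%N; split; [by lia|by lia|by rewrite natrM natrD].
have k0 : 0 < 1 / (2 * M%:R) :> R by rewrite divr_gt0// mulr_gt0// ltr0n.
have [t wt] := exists_well_spread n Om_nonempty Om_slopes Om_lacunary k0.
have np : 0 < n%:R :> R by rewrite ltr0n nE expn_gt0.
pose N : R := #|sample M t|%:R.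
have N0 : 0 < N by rewrite ltr0n card_sample.
pose E (om : sample M t) := [set z : plane R | survives (side M) om z].
pose E' (om : sample M t) := [set z : plane R | survives (near_side M) om z].
have mfar : measurable (@far_box R) by apply: measurableX; exact: measurable_itv.
have mshell j : measurable (@dyadic_shell R j).
  by apply: measurableX; exact: measurable_itv.
have mE om : measurable (E om) by exact: measurable_survives.
have mE' om : measurable (E' om) by exact: measurable_survives.
have lfar : lebesgue2 R (@far_box R) = (5 / 2)%:E.
  by rewrite lebesgue2_box; [congr _%:E; lra|lra|lra].
have lshell j : lebesgue2 R (@dyadic_shell R j) = (2 ^- j.+2)%:E.
  have ltj : 2 ^- j.+2 < 2 ^- j.+1 :> R.
    by rewrite ltf_pV2 ?posrE ?exprn_gt0// ltr_eXn2l// ltr1n.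
  rewrite lebesgue2_box//; congr _%:E.
  by rewrite subr0 mulr1 (exprVnS R j.+1) addrK.
have upper : (\sum_om lebesgue2 R (E' om `&` @far_box R) <=
    (10 / (n%:R + 10) * N * (5 / 2))%:E)%E.
  rewrite [X in (_ <= X)%E]EFinM -lfar; apply: sum_measure_le => // z [z1 _].
  rewrite sum_indic_survives//; apply: ler_wpM2r; first exact: ltW.
  by apply: (survival_upper M2 wt); move: z1; rewrite /= in_itv.
have lower j : (j < J)%N ->
    ((N / (4 * n%:R))%:E <= \sum_om lebesgue2 R (E om `&` @dyadic_shell R j))%E.
  move=> jJ; have -> : N / (4 * n%:R) = 2 ^+ j / 2 ^+ J.+1 * N * 2 ^- j.+2.
    by rewrite nE natrX !(exprS _ j.+1) (exprS _ j); field; rewrite !expf_neq0.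
  rewrite EFinM -lshell; apply: sum_measure_ge => //.
    by rewrite mulr_ge0 ?divr_ge0 ?exprn_ge0// ltW.
  move=> z zj; rewrite sum_indic_survives//; apply: ler_wpM2r; first exact: ltW.
  by rewrite nE in wt nM; exact: survival_shell wt zj.
(* For each fixed outcome, the assumed bound is applied to the indicator of the far part, on the
   disjoint union of the [J] near pieces. *)
have weak om : (\sum_(j < J) lebesgue2 R (E om `&` @dyadic_shell R j) <=
    K%:E * lebesgue2 R (E' om `&` @far_box R))%E.
  have mEj j : measurable (E om `&` @dyadic_shell R j) by exact: measurableI.
  have disj : trivIset setT (fun j => E om `&` @dyadic_shell R j).
    by apply: trivIset_setIl; exact: trivIset_dyadic_shell.
  rewrite -(measure_bigsetU (lebesgue2 R) mEj disj).
  apply: (maximal_measure_le p_ge1 bound).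
  - by apply: bigsetU_measurable => j _; exact: mEj.
  - exact: measurableI.
  - apply: (@le_lt_trans _ _ (lebesgue2 R (@far_box R))); last by rewrite lfar ltry.
    by rewrite le_measure ?inE//; exact: measurableI.
  move=> z; rewrite -(bigcup_mkord J (fun j => E om `&` @dyadic_shell R j)) => -[j _ [Ez [/=]]].
  rewrite !in_itv /= => z1 z2.
  apply: survives_maximal_op_ge wt _ z2 Ez => //.
  have : 2 ^- j.+1 <= 1 / 2 :> R.
    by rewrite div1r lef_pV2 ?posrE ?exprn_gt0// -[leLHS]expr1 ler_weXn2l// ler1n.
  have : 0 <= 2 ^- j.+2 :> R by rewrite invr_ge0 exprn_ge0.
  lra.
(* Sum [weak] over all outcomes: each shell brings at least [N / (4 * n)] on the left, and the far
   parts bring at most [25 * N / (n + 10)] on the right. *)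
have : ((J%:R * (N / (4 * n%:R)))%:E <= (K * (10 / (n%:R + 10) * N * (5 / 2)))%:E)%E.
  apply: (@le_trans _ _
    (\sum_(j < J) \sum_om lebesgue2 R (E om `&` @dyadic_shell R j))%E).
    rewrite mulr_natl -[in leLHS](card_ord J) -sumr_const -sumEFin.
    by apply: lee_sum => j _; exact: lower.
  rewrite exchange_big EFinM /=.
  apply: (@le_trans _ _ (\sum_om K%:E * lebesgue2 R (E' om `&` @far_box R))%E).
    by apply: lee_sum => om _; exact: weak.
  rewrite -ge0_sume_distrr//; by apply: lee_wpmul2l => //; rewrite lee_fin.
rewrite lee_fin; apply/negP; rewrite -ltNge.
have h : 10 / (n%:R + 10) <= 10 / n%:R :> R.
  by rewrite ler_pM2l// lef_pV2 ?posrE; lra.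
apply: (@le_lt_trans _ _ (K * (10 / n%:R * N * (5 / 2)))).
  by apply: ler_wpM2l => //; apply: ler_wpM2r; [lra|apply: ler_wpM2r; [exact: ltW|]].
have -> : K * (10 / n%:R * N * (5 / 2)) = 100 * K * (N / (4 * n%:R)).
  by field; rewrite gt_eqF.
by rewrite ltr_pM2r// divr_gt0// mulr_gt0.
Qed.
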